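(* Let $F$ be a finite field, $n\ge 1$, and let $\varnothing\ne S\subseteq M_n(F)$ be polynomial finite, with standard factorization $\mu_S=\prod_{i=1}^k p_i^{c_i}$ of its minimal polynomial into powers of distinct monic irreducible polynomials $p_i\in F[x]$ ($c_i\ge 1$). For $1\le i\le k$ let $S_{p_i}=\{A\in S : p_i^{c_i}\mid m_A\}$. Then $$S\text{ is a core set}\iff \forall\,1\le i\le k,\ \bigcap_{A\in S_{p_i}}\mathcal{B}\Big(A,\frac{m_A}{p_i}\Big)=\{0\}.$$ In particular, if $\varnothing\ne S\subseteq\mathcal{C}$ for a similarity class $\mathcal{C}\subseteq M_n(F)$ whose elements have minimal polynomial $\mu$, and $p_1,\dots,p_k$ are all the (distinct monic) irreducible factors of $\mu$, then $$S\text{ is a core set}\iff \forall\,1\le i\le k,\ \bigcap_{A\in S}\mathcal{B}\Big(A,\frac{\mu}{p_i}\Big)=\{0\}.$$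
   Context: In $M_n(F)[x]$ the indeterminate $x$ commutes with all coefficients, and $F[x]\subseteq M_n(F)[x]$ via scalar matrices. Evaluation is with $x$ to the right of the coefficients: for $f=\sum_k B_kx^k$ and $A\in M_n(F)$, $f(A)=\sum_k B_kA^k$. For $S\subseteq M_n(F)$, $N(S)=\{f\in M_n(F)[x] : f(A)=0\ \text{for all } A\in S\}$; $S$ is a core set if $N(S)$ is a two-sided ideal of $M_n(F)[x]$. $m_A\in F[x]$ is the minimal polynomial of $A$. A nonempty $S$ is polynomial finite if the family $\{m_A : A\in S\}$ has a monic least common multiple in $F[x]$; this least common multiple is the minimal polynomial $\mu_S$ of $S$. For $A\in M_n(F)$ and $g\in F[x]$ with $g\mid m_A$, $\mathcal{B}(A,g)=\{f\in M_n(F)[x] : (fg)(A)=0,\ \deg f<\deg m_A-\deg g\}$ (the zero polynomial is always included, with $\deg 0=-\infty$). A similarity class is an orbit of $M_n(F)$ under conjugation by $\mathrm{GL}(n,F)$. *)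

(* Defs.v *)
From HB Require Import structures.
From mathcomp Require Import all_boot all_order all_algebra.

Set Implicit Arguments.
Unset Strict Implicit.
Unset Printing Implicit Defensive.

Import GRing.Theory.
Local Open Scope ring_scope.

Definition two_sided_ideal (R : nzRingType) (I : {pred R}) : Prop :=
  zmod_closed I /\
  (forall a f : R, f \in I -> a * f \in I /\ f * a \in I).

Section NullPolynomials.
Variables (F : finFieldType) (n : nat).
Implicit Types (A : 'M[F]_n.+1) (S C : {set 'M[F]_n.+1}) (g mu : {poly F}).

(* The embedding of F[x] into M_n(F)[x] through scalar matrices. *)
Definition scalar_poly g : {poly 'M[F]_n.+1} := map_poly (@scalar_mx F n.+1) g.

(* The Horner evaluation f.[A] is \sum_k f`_k * A ^+ k: powers of A stand to
   the right of the coefficients. *)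
Definition null_polys S : {pred {poly 'M[F]_n.+1}} :=
  [pred f | [forall A in S, f.[A] == 0]].

Definition core_set S : Prop := two_sided_ideal (null_polys S).

Definition set_minpoly S mu : Prop :=
  [/\ mu \is monic,
      forall A, A \in S -> mxminpoly A %| mu
    & forall q : {poly F},
        (forall A, A \in S -> mxminpoly A %| q) -> mu %| q].

Definition polynomial_finite S : Prop :=
  S != set0 /\ exists mu : {poly F}, set_minpoly S mu.

(* Meant for g %| mxminpoly A. Then g != 0 and the truncated subtraction is
   deg m_A - deg g. As size f is deg f + 1 for f != 0 and size 0 = 0, the
   bound says that f = 0 or deg f < deg m_A - deg g. *)
Definition Bset A g : {pred {poly 'M[F]_n.+1}} :=
  [pred f | ((f * scalar_poly g).[A] == 0)
            && (size f <= size (mxminpoly A) - size g)%N].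

Definition similarity_class C : Prop :=
  exists A, C = [set P *m A *m invmx P | P : 'M[F]_n.+1 in unitmx].

End NullPolynomials.

Definition standard_factorization (F : fieldType) (mu : {poly F}) (k : nat)
    (p : 'I_k -> {poly F}) (c : 'I_k -> nat) : Prop :=
  [/\ injective p,
      forall i, p i \is monic /\ irreducible_poly (p i),
      forall i, (0 < c i)%N
    & mu = \prod_(i < k) p i ^+ c i].

Definition all_irreducible_factors (F : fieldType) (mu : {poly F}) (k : nat)
    (p : 'I_k -> {poly F}) : Prop :=
  injective p /\
  (forall q : {poly F},
     [/\ q \is monic, irreducible_poly q & q %| mu] <-> exists i, q = p i).

(* Main.v *)
Require Import Defs.
From HB Require Import structures.
From mathcomp Require Import all_boot all_order all_algebra.
Import GRing.Theory.
Local Open Scope ring_scope.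

(* Write s(g) for the scalar polynomial of g in F[x]; s(g) is central and
   (f s(g))(A) = f(A) g(A). If N(S) is two-sided, then for f in N(S) the scalar
   polynomial of each entry of f, being a sum of products of f with matrix
   units, lies in N(S), so that mu divides every entry. Hence S is a core set
   iff every f in N(S) is a multiple of s(mu).
   If S is a core set and f lies in the intersection attached to p, then
   f s(mu / p) is in N(S), so p divides f, which has degree < deg p.
   Conversely, if some f in N(S) is not a multiple of s(mu), then removing one
   irreducible factor d -> d / p at a time, starting from d = mu, until f s(d / p)
   is no longer a multiple of s(mu), yields p and a nonzero g of degree < deg p
   with g s(mu / p) in N(S). For A in S_p the
   quotient mu / m_A is prime to p, so Bezout gives (g s(m_A / p))(A) = 0. *)

(** * Scalar polynomials inside the matrix polynomial ring *)

Lemma size_scalar_poly {F : finFieldType} (n : nat) {g : {poly F}} :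
  size (scalar_poly n g) = size g.
Proof. by rewrite size_map_poly. Qed.

Lemma monic_scalar_poly {F : finFieldType} (n : nat) {g : {poly F}} :
  g \is monic -> scalar_poly n g \is monic.
Proof. by rewrite map_monic. Qed.

Lemma scalar_polyM {F : finFieldType} (n : nat) (g h : {poly F}) :
  scalar_poly n (g * h) = scalar_poly n g * scalar_poly n h.
Proof. exact: rmorphM. Qed.

Lemma scalar_poly_central (F : finFieldType) (n : nat)
    (f : {poly 'M[F]_n.+1}) (g : {poly F}) :
  f * scalar_poly n g = scalar_poly n g * f.
Proof.
apply/polyP => i; rewrite coefM coefMr; apply: eq_bigr => j _.
by rewrite coef_map; apply: scalar_mxC.
Qed.

Lemma horner_mul_scalar_poly (F : finFieldType) (n : nat)
    (f : {poly 'M[F]_n.+1}) (g : {poly F}) (A : 'M[F]_n.+1) :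
  (f * scalar_poly n g).[A] = f.[A] * horner_mx A g.
Proof.
by apply: hornerM_comm; apply: (comm_mx_horner (A := A) (B := A) g).
Qed.

(** Factoring each matrix unit through dimension one squeezes [M] into a 1 x 1 matrix, a scalar that
    can be pulled out. *)
Lemma mul_delta_mx_entry (R : comNzRingType) (n : nat) (M : 'M[R]_n)
    (i j k : 'I_n) :
  delta_mx k i *m M *m delta_mx j k = M i j *: delta_mx k k.
Proof.
rewrite -(mul_delta_mx (0 : 'I_1) k i) -(mul_delta_mx (0 : 'I_1) j k).
rewrite -2!(mulmxA (delta_mx k 0)) -rowE !mulmxA -(mulmxA _ (row i M)) -colE.
by rewrite [col _ _]mx11_scalar !mxE mul_mx_scalar -scalemxAl mul_delta_mx.
Qed.

(** Puts the entries of [f], as scalar polynomials, in the two-sided ideal generated by [f]; the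
    diagonal matrix units sum to the identity. *)
Lemma scalar_poly_entry {F : finFieldType} {n : nat}
    (f : {poly 'M[F]_n.+1}) (i j : 'I_n.+1) :
  scalar_poly n (map_poly (fun M : 'M[F]_n.+1 => M i j) f)
    = \sum_k (delta_mx k i)%:P * f * (delta_mx j k)%:P.
Proof.
apply/polyP => l; rewrite coef_map /= coef_map_id0 ?mxE // coef_sum.
rewrite scalar_mx_sum_delta; apply: eq_bigr => k _.
by rewrite coefMC coefCM -mul_delta_mx_entry.
Qed.

(** * Null polynomials and core sets *)

Lemma null_polysP {F : finFieldType} {n : nat} {S : {set 'M[F]_n.+1}}
    {f : {poly 'M[F]_n.+1}} :
  reflect (forall A, A \in S -> f.[A] = 0) (f \in null_polys S).
Proof. by apply: (iffP forall_inP) => H A AS; apply/eqP/H. Qed.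

Lemma scalar_poly_null {F : finFieldType} {n : nat} {S : {set 'M[F]_n.+1}}
    {mu : {poly F}} (g : {poly F}) :
  set_minpoly S mu -> (scalar_poly n g \in null_polys S) = (mu %| g).
Proof.
case=> _ mA_mu mu_min; apply/null_polysP/idP => [g0 | /dvdpP [q ->] A AS].
  by apply: mu_min => A AS; apply: mxminpoly_min; apply: g0.
by rewrite -[LHS]/(horner_mx A (q * mu)); apply/mxminpoly_minP/dvdp_mull/mA_mu.
Qed.

Lemma core_setP {F : finFieldType} {n : nat} {S : {set 'M[F]_n.+1}}
    {mu : {poly F}} :
  set_minpoly S mu ->
  core_set S <->
    forall f, f \in null_polys S -> exists q, f = q * scalar_poly n mu.
Proof.
move=> Smu; have [mu_mon mA_mu _] := Smu; split=> [[[N0 NB] NM] f fN | Ndvd].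
  (* The divisor is monic, so division with remainder works over the noncommutative coefficient
     ring. *)
  have s_mon := monic_scalar_poly n mu_mon.
  set q := Pdiv.Ring.rdivp f (scalar_poly n mu).
  set r := Pdiv.Ring.rmodp f (scalar_poly n mu).
  have def_f : f = q * scalar_poly n mu + r by apply: Pdiv.RingMonic.rdivp_eq.
  exists q; rewrite {1}def_f; suff -> : r = 0 by rewrite addr0.
  have rN : r \in null_polys S.
    have -> : r = f - q * scalar_poly n mu by rewrite {1}def_f addrC addKr.
    apply: NB => //; apply: (NM q _ _).1.
    by rewrite (scalar_poly_null _ Smu).
  have szr : (size r < size mu)%N.
    by rewrite -(size_scalar_poly n) Pdiv.Ring.ltn_rmodpN0 ?monic_neq0.
  apply/polyP => l; rewrite coef0; apply/matrixP => i j; rewrite mxE.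
  have: map_poly (fun M : 'M[F]_n.+1 => M i j) r = 0.
    apply/eqP; apply: contraTT szr => e_nz; rewrite -leqNgt.
    apply: leq_trans (size_poly _ (fun i => _)); apply: dvdp_leq e_nz _.
    rewrite -(scalar_poly_null _ Smu) scalar_poly_entry.
    elim/big_ind: _ => [|g h gN hN|k _] //.
      (* [zmod_closed] gives closure under subtraction only, so [g + h] is read as [g - (0 - h)]. *)
      by rewrite -[h]opprK NB // -sub0r NB.
    by apply: (NM _ _ _).2; apply: (NM _ _ _).1.
  by move/(congr1 (coefp l)); rewrite /= coef_map_id0 ?coef0 ?mxE.
have dvdN q : q * scalar_poly n mu \in null_polys S.
  apply/null_polysP => A AS; rewrite horner_mul_scalar_poly.
  by rewrite (mxminpoly_minP A mu _) ?mulr0 // mA_mu.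
split=> [|a f /Ndvd [q ->]]; first split.
- by apply/null_polysP => A _; rewrite horner0.
- move=> f g /null_polysP f0 /null_polysP g0; apply/null_polysP => A AS.
  by rewrite hornerD hornerN f0 // g0 // subrr.
- by rewrite mulrA dvdN -mulrA -scalar_poly_central mulrA dvdN.
Qed.

(** * Irreducible factors and multiplicities in F[x] *)

Lemma irreducible_factor (F : finFieldType) (d : {poly F}) :
  (1 < size d)%N ->
  exists p, [/\ p \is monic, irreducible_poly p & p %| d].
Proof.
elim: {d}_.+1 {-2}d (ltnSn (size d)) => // m IHm d; rewrite ltnS => szd d_gt1.
have d_nz : d != 0 by rewrite -size_poly_gt0 ltnW.
have lc_nz : (lead_coef d)^-1 != 0 by rewrite invr_eq0 lead_coef_eq0.
have [d_irr | ] := boolP (irreducibleb d).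
  exists ((lead_coef d)^-1 *: d); split; last by rewrite dvdpZl.
    by rewrite monicE lead_coefZ mulVf ?lead_coef_eq0.
  have [_ d_min] := irreducibleP _ d_irr.
  split=> [|q q1 q_dvd]; first by rewrite size_scale.
  rewrite dvdpZr // in q_dvd; rewrite (eqp_trans (d_min q q1 q_dvd)) //.
  by rewrite eqp_sym eqp_scale.
(* [irreducibleb] tests the finitely many polynomials of size below that of [d], so its failure
   yields a proper nonconstant divisor. *)
rewrite negb_and d_gt1 /= => /forallPn [q]; rewrite negb_imply -ltnNge.
rewrite -Pdiv.Idomain.dvdpE => /andP [q_dvd q_gt1].
have q_lt : (size q < size d)%N.
  by rewrite (leq_ltn_trans (size_npoly q)) // ltn_predL ltnW.
have [p [p_mon p_irr p_q]] := IHm q (leq_trans q_lt szd) q_gt1.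
by exists p; split=> //; apply: dvdp_trans q_dvd.
Qed.

Lemma size_divp_irreducible {F : fieldType} {p d : {poly F}} :
  irreducible_poly p -> d != 0 -> (size (d %/ p)%R < size d)%N.
Proof.
move=> p_irr d_nz; rewrite size_divp ?irredp_neq0 // ltn_subrL.
by rewrite size_poly_gt0 d_nz andbT -ltnS prednK ?p_irr.1 // ltnW ?p_irr.1.
Qed.

Lemma ndvdp_divp_irreducible {F : fieldType} {p d : {poly F}} :
  irreducible_poly p -> d != 0 -> p %| d -> ~~ (d %| d %/ p).
Proof.
move=> p_irr d_nz p_d; apply/negP => /dvdp_leq.
by rewrite dvdp_div_eq0 // d_nz leqNgt size_divp_irreducible // => /(_ isT).
Qed.

Lemma irreducible_dvdp_exp {F : fieldType} {p q : {poly F}} {m : nat} :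
  irreducible_poly p -> p %| q ^+ m -> p %| q.
Proof.
move=> p_irr; apply: contraLR => p_q.
rewrite -irreducible_poly_coprime // coprimep_expr //.
by rewrite irreducible_poly_coprime.
Qed.

Lemma irreducible_monic_dvdp {F : fieldType} {p q : {poly F}} :
  p \is monic -> q \is monic -> irreducible_poly p -> irreducible_poly q ->
  p %| q -> p = q.
Proof.
move=> p_mon q_mon [p_gt1 _] [_ q_min] p_q; apply/eqP.
by rewrite -eqp_monic // q_min // neq_ltn p_gt1 orbT.
Qed.

Lemma irreducible_dvdp_standard_factorization {F : fieldType} {mu : {poly F}}
    {k : nat} {p : 'I_k -> {poly F}} {c : 'I_k -> nat} {q : {poly F}} :
  standard_factorization mu p c -> q \is monic -> irreducible_poly q ->
  q %| mu -> exists i, q = p i.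
Proof.
case=> _ p_irr _ -> q_mon q_irr; elim/big_ind: _ => [|g h IHg IHh|i _].
- by rewrite dvdp1 => /eqP q1; case: q_irr; rewrite q1.
- have [/IHg //|q_g] := boolP (q %| g).
  by rewrite Gauss_dvdpr ?irreducible_poly_coprime.
- move/(irreducible_dvdp_exp q_irr) => q_p; exists i.
  have [p_mon p_i] := p_irr i; exact: irreducible_monic_dvdp.
Qed.

(** If [p] divided the cofactor [u], cancelling it would give m | mu / p. So [u] is prime to [p],
    and p | u m forces p | m. *)
Lemma dvdp_divp_irreducible {F : fieldType} {p m mu : {poly F}} :
  irreducible_poly p -> p %| mu -> m %| mu -> ~~ (m %| mu %/ p) ->
  exists u, [/\ mu = u * m, coprimep p u & p %| m].
Proof.
move=> p_irr p_mu /dvdpP [u def_mu] m_ndvd; have p_nz := irredp_neq0 p_irr.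
have p_u : ~~ (p %| u).
  apply: contra m_ndvd => /dvdpP [v def_u].
  by rewrite def_mu def_u mulrAC mulpK // dvdp_mull.
have co_pu : coprimep p u by rewrite irreducible_poly_coprime.
have p_m : p %| m by rewrite -(Gauss_dvdpr m co_pu) -def_mu.
by exists u.
Qed.

(** Trades membership in S_p for a condition free of exponents. Left to right, m | mu / p would make
    [p i] divide the product [r] of the other prime powers; right to left, the cofactor of [m] is
    prime to [p i]. *)
Lemma dvdp_exp_standard_factorization {F : fieldType} {mu : {poly F}}
    {k : nat} {p : 'I_k -> {poly F}} {c : 'I_k -> nat} {m : {poly F}}
    (i : 'I_k) :
  standard_factorization mu p c -> m %| mu ->
  (p i ^+ c i %| m) = ~~ (m %| mu %/ p i).
Proof.
case=> p_inj p_irr c_gt0 def_mu m_mu; have [pi_mon pi_irr] := p_irr i.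
have pi_nz := irredp_neq0 pi_irr.
set r := \prod_(j < k | j != i) p j ^+ c j.
have {}def_mu : mu = p i ^+ c i * r by rewrite def_mu (bigD1 i).
have p_r : ~~ (p i %| r).
  rewrite /r; elim/big_ind: _ => [|g h p_g p_h|j j_i].
  - by rewrite dvdp1 neq_ltn pi_irr.1 orbT.
  - by rewrite Gauss_dvdpr ?irreducible_poly_coprime.
  - apply: contra j_i => /(irreducible_dvdp_exp pi_irr) p_p.
    apply/eqP/esym/p_inj.
    by have [pj_mon pj_irr] := p_irr j; apply: irreducible_monic_dvdp.
have p_mu : p i %| mu.
  by rewrite def_mu dvdp_mulr // -(prednK (c_gt0 i)) exprS dvdp_mulr.
apply/idP/idP => [pc_m | m_ndvd].
  apply/negP => /(dvdp_trans pc_m).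
  rewrite def_mu -(prednK (c_gt0 i)) exprSr -mulrA mulrCA mulKp //=.
  by rewrite dvdp_mul2l ?expf_neq0 //; apply/negP.
have [u [def_u co_pu _]] := dvdp_divp_irreducible pi_irr p_mu m_mu m_ndvd.
by rewrite -(Gauss_dvdpr m (coprimep_expl _ co_pu)) -def_u def_mu dvdp_mulr.
Qed.

(** * The criterion over all monic irreducible divisors of mu *)

(* The condition [~~ (mxminpoly A %| mu %/ p)] says that p occurs in m_A with
   the same multiplicity as in mu, without naming this multiplicity. *)
Lemma core_set_irreducibleP {F : finFieldType} {n : nat}
    {S : {set 'M[F]_n.+1}} {mu : {poly F}} :
  set_minpoly S mu ->
  core_set S <->
    forall p, p \is monic -> irreducible_poly p -> p %| mu ->
    forall f,
      (forall A, A \in S -> ~~ (mxminpoly A %| mu %/ p) ->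
         f \in Bset A (mxminpoly A %/ p)) ->
      f = 0.
Proof.
move=> Smu; have [mu_mon mA_mu mu_min] := Smu.
have mu_nz := monic_neq0 mu_mon.
have nu_mon p : p \is monic -> p %| mu -> mu %/ p \is monic.
  by move=> p_mon p_mu; rewrite -(monicMr _ p_mon) divpK.
(* The degree bound in B(A, m_A / p) is deg p, whatever [A] is. *)
have szB (A : 'M[F]_n.+1) p : p %| mxminpoly A -> p != 0 ->
    (size (mxminpoly A) - size (mxminpoly A %/ p)%R = (size p).-1)%N.
  move=> p_m p_nz; rewrite size_divp // subKn // (leq_trans (leq_pred _)) //.
  by rewrite dvdp_leq // monic_neq0 // mxminpoly_monic.
apply: iff_trans (core_setP Smu) _; split.
  move=> Ndvd p p_mon p_irr p_mu f fB.
  have nu_nz := monic_neq0 (nu_mon p p_mon p_mu).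
  have [q def_f] : exists q, f * scalar_poly n (mu %/ p) = q * scalar_poly n mu.
    apply/Ndvd/null_polysP => A AS; rewrite horner_mul_scalar_poly.
    have [/mxminpoly_minP -> | m_ndvd] := boolP (mxminpoly A %| mu %/ p).
      by rewrite mulr0.
    have [u [{1}-> _ p_m]] :=
      dvdp_divp_irreducible p_irr p_mu (mA_mu A AS) m_ndvd.
    rewrite -divp_mulA //.
    have /andP [/eqP fA0 _] := fB A AS m_ndvd.
    by rewrite mulrC rmorphM /= mulrA -horner_mul_scalar_poly fA0 mul0r.
  have {}def_f : f = q * scalar_poly n p.
    apply: (monic_rreg (monic_scalar_poly n (nu_mon p p_mon p_mu))).
    by rewrite def_f -mulrA -scalar_polyM [p * _]mulrC divpK.
  (* Were there no such [A], mu / p would be a common multiple of all m_A. One such [A] is needed to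
     bound the degree of [f]. *)
  have [A AS m_ndvd] : exists2 A, A \in S & ~~ (mxminpoly A %| mu %/ p).
    apply/exists_inP; apply: contraT; rewrite negb_exists => /forallP m_dvd.
    rewrite -(negPf (ndvdp_divp_irreducible p_irr mu_nz p_mu)); apply: mu_min.
    by move=> A AS; have := m_dvd A; rewrite AS negbK.
  have [_ [_ _ p_m]] := dvdp_divp_irreducible p_irr p_mu (mA_mu A AS) m_ndvd.
  have /andP [_] := fB A AS m_ndvd; rewrite szB ?irredp_neq0 // def_f.
  have [-> | q_nz] := eqVneq q 0; first by rewrite mul0r.
  rewrite size_Mmonic ?monic_scalar_poly // size_scalar_poly.
  move: q_nz (irredp_neq0 p_irr); rewrite -!size_poly_gt0.
  case: (size q) (size p) => [|a] [|b] //= _ _.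
  by rewrite addnS ltnNge leq_addl.
(* Induction on a bound for the size of [d], from d = mu, where [q] is [f] itself, down to d = 1,
   which is the claim. *)
move=> B0 f fN; suff reduce m (d : {poly F}) :
    (size d <= m)%N -> d \is monic -> d %| mu ->
    (exists q, f * scalar_poly n d = q * scalar_poly n mu) ->
    exists q, f = q * scalar_poly n mu.
  by apply: (reduce (size mu) mu) => //; exists f.
elim: m d => [|m IHm] d szd d_mon d_mu [q def_fd].
  by move: szd; rewrite leqNgt size_poly_gt0 monic_neq0.
have [d_le1 | d_gt1] := leqP (size d) 1.
  have d1 : d = 1.
    rewrite (size1_polyC d_le1); congr _%:P; have := monicP d_mon.
    by rewrite {1}(size1_polyC d_le1) lead_coefC.
  by exists q; rewrite -def_fd d1 /scalar_poly rmorph1 mulr1.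
have [p [p_mon p_irr p_d]] := irreducible_factor F d d_gt1.
have p_mu := dvdp_trans p_d d_mu.
have d'_mon : d %/ p \is monic by rewrite -(monicMr _ p_mon) divpK.
apply: (IHm (d %/ p)) => //.
- by rewrite -ltnS (leq_trans _ szd) // size_divp_irreducible ?monic_neq0.
- by apply: dvdp_trans d_mu; apply: divp_dvd.
have {}def_fd : f * scalar_poly n (d %/ p) = q * scalar_poly n (mu %/ p).
  apply: (monic_rreg (monic_scalar_poly n p_mon)).
  by rewrite -!mulrA -!scalar_polyM !divpK.
(* Reducing [q] modulo s(p) changes q s(mu / p) = f s(d / p) only by a multiple of s(mu), so the
   remainder [g] times s(mu / p) is still null on [S]. *)
set a := Pdiv.Ring.rdivp q (scalar_poly n p).
set g := Pdiv.Ring.rmodp q (scalar_poly n p).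
have def_q : q = a * scalar_poly n p + g.
  exact/Pdiv.RingMonic.rdivp_eq/monic_scalar_poly.
suff g0 : g = 0.
  exists a; rewrite def_fd def_q g0 addr0 -mulrA -scalar_polyM.
  by rewrite [p * _]mulrC divpK.
apply: (B0 p) => // A AS m_ndvd.
have [u [def_mu co_pu p_m]] :=
  dvdp_divp_irreducible p_irr p_mu (mA_mu A AS) m_ndvd.
rewrite inE szB ?irredp_neq0 // -ltnS prednK ?size_poly_gt0 ?irredp_neq0 //.
rewrite -(size_scalar_poly n) Pdiv.Ring.ltn_rmodpN0 ?andbT; last first.
  exact/monic_neq0/monic_scalar_poly.
have gnu0 : g.[A] * horner_mx A (mu %/ p) = 0.
  have -> : g = q - a * scalar_poly n p by rewrite def_q addrC addKr.
  rewrite -horner_mul_scalar_poly mulrBl -def_fd -mulrA -scalar_polyM.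
  rewrite [p * _]mulrC divpK // hornerD hornerN !horner_mul_scalar_poly.
  rewrite (null_polysP fN A AS) (mxminpoly_minP A mu (mA_mu A AS)).
  by rewrite mul0r mulr0 subrr.
have /Bezout_eq1_coprimepP [[v w] /= vw1] := co_pu.
(* The Bezout relation v p + w u = 1 times m_A / p: the first term vanishes at [A], and the second
   contains mu / p, which [g.[A]] annihilates. *)
have -> : mxminpoly A %/ p = v * mxminpoly A + mu %/ p * w.
  rewrite -[LHS]mul1r -vw1 mulrDl def_mu -divp_mulA // -mulrA.
  by rewrite [p * _]mulrC divpK // [w * u]mulrC mulrAC.
rewrite horner_mul_scalar_poly rmorphD !rmorphM /= mx_root_minpoly mulr0 add0r.
by rewrite mulrA gnu0 mul0r.
Qed.

Theorem proposition3p4 (F : finFieldType) (n : nat) :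
  (forall (S : {set 'M[F]_n.+1}) (mu : {poly F}) (k : nat)
          (p : 'I_k -> {poly F}) (c : 'I_k -> nat),
     S != set0 -> polynomial_finite S -> set_minpoly S mu ->
     standard_factorization mu p c ->
     (core_set S <->
      forall (i : 'I_k) (f : {poly 'M[F]_n.+1}),
        (forall A : 'M[F]_n.+1,
           A \in [set A' in S | p i ^+ c i %| mxminpoly A'] ->
           f \in Bset A (mxminpoly A %/ p i))
        <-> f = 0))
  /\
  (forall (C S : {set 'M[F]_n.+1}) (mu : {poly F}) (k : nat)
          (p : 'I_k -> {poly F}),
     similarity_class C -> (forall A, A \in C -> mxminpoly A = mu) ->
     S != set0 -> S \subset C ->
     all_irreducible_factors mu p ->
     (core_set S <->
      forall (i : 'I_k) (f : {poly 'M[F]_n.+1}),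
        (forall A : 'M[F]_n.+1, A \in S -> f \in Bset A (mu %/ p i))
        <-> f = 0)).
Proof.
have zero_B (A : 'M[F]_n.+1) g : 0 \in Bset A g.
  by rewrite inE mul0r horner0 eqxx size_poly0.
split=> [S mu k p c _ _ Smu fact | C S mu k p _ C_mu S_nz SC [p_inj pP]].
  have [p_inj p_irr c_gt0 def_mu] := fact.
  have [mu_mon mA_mu _] := Smu.
  have pc_dvd i A : A \in S ->
      (p i ^+ c i %| mxminpoly A) = ~~ (mxminpoly A %| mu %/ p i).
    move=> AS; exact: (dvdp_exp_standard_factorization i fact (mA_mu A AS)).
  have p_mu i : p i %| mu.
    rewrite def_mu (bigD1 i) //= dvdp_mulr //.
    by rewrite -(prednK (c_gt0 i)) exprS dvdp_mulr.
  apply: iff_trans (core_set_irreducibleP Smu) _.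
  split=> [B0 i f | B0 q q_mon q_irr q_mu f fB].
    split=> [fB | -> A _]; last exact: zero_B.
    have [pi_mon pi_irr] := p_irr i; apply: (B0 (p i)) => // A AS m_ndvd.
    by apply: fB; rewrite inE AS pc_dvd.
  have [i def_q] :=
    irreducible_dvdp_standard_factorization fact q_mon q_irr q_mu.
  apply/(B0 i f) => A; rewrite inE => /andP [AS]; rewrite pc_dvd // -def_q.
  exact: fB.
have S_mu A : A \in S -> mxminpoly A = mu by move=> AS; apply/C_mu/(subsetP SC).
have [A0 A0S] := set0Pn _ S_nz.
have mu_mon : mu \is monic by rewrite -(S_mu A0 A0S) mxminpoly_monic.
(* All m_A with [A] in [S] equal [mu], which is thus their least common multiple. *)
have Smu : set_minpoly S mu.
  split=> // [A /S_mu -> // | q mA_q].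
  by rewrite -(S_mu A0 A0S) mA_q.
apply: iff_trans (core_set_irreducibleP Smu) _.
split=> [B0 i f | B0 q q_mon q_irr q_mu f fB].
  split=> [fB | -> A _]; last exact: zero_B.
  have [pi_mon pi_irr pi_mu] := (pP (p i)).2 (ex_intro _ i erefl).
  by apply: (B0 (p i)) => // A AS _; rewrite S_mu // fB.
have [i def_q] := (pP q).1 (And3 q_mon q_irr q_mu).
apply/(B0 i f) => A AS; rewrite -def_q -{1}(S_mu A AS); apply: fB => //.
(* Within one class every [A] carries the full multiplicity of [q], as [mu] does not divide mu /
   q. *)
by rewrite S_mu // ndvdp_divp_irreducible ?monic_neq0.
Qed.
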